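(* There exists a strictly positive, bounded, continuous and integrable function $f:\mathbb{R}\to\mathbb{R}$ for which the Fourier transform $\mathcal{F}f$ is not integrable on $\mathbb{R}$, i.e. $\mathcal{F}f\notin L^1(\mathbb{R})$.
   Context: Integrability is with respect to Lebesgue measure on $\mathbb{R}$, and $\mathcal{F}f(t)=\int_{-\infty}^{\infty}e^{-itx}f(x)\,dx$ for $t\in\mathbb{R}$. *)

(* Defs.v *)
From HB Require Import structures.
From mathcomp Require Import all_boot all_order all_algebra.
From mathcomp Require Import all_classical all_reals all_analysis.
From mathcomp Require Import complex.

Set Implicit Arguments.
Unset Strict Implicit.
Unset Printing Implicit Defensive.

Import Order.TTheory GRing.Theory Num.Theory.
Import numFieldNormedType.Exports.

Local Open Scope classical_set_scope.
Local Open Scope complex_scope.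
Local Open Scope ring_scope.

(* [cos], [sin] and [expR] are the real functions; by Euler's formula this is
   the entire function [\sum_n z ^+ n / n`!]. *)
Definition cexp (R : realType) (z : R[i]) : R[i] :=
  (expR (complex.Re z))%:C * (cos (complex.Im z) +i* sin (complex.Im z)).

Definition cmeasurable_fun (d : measure_display) (T : measurableType d)
    (R : realType) (D : set T) (g : T -> R[i]) : Prop :=
  measurable_fun D (fun x => complex.Re (g x)) /\
  measurable_fun D (fun x => complex.Im (g x)).

(* [Normc.normc] is the real-valued modulus on [R[i]]; the norm [`|z|] lives
   in [R[i]] itself. *)
Definition cintegrable (d : measure_display) (T : measurableType d)
    (R : realType) (mu : {measure set T -> \bar R}) (D : set T)
    (g : T -> R[i]) : Prop :=
  cmeasurable_fun D g /\
  (\int[mu]_(x in D) (Normc.normc (g x))%:E < +oo)%E.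

(* Like [Rintegral], this is total; it is the Lebesgue integral of [g]
   whenever [cintegrable mu D g]. *)
Definition Cintegral (d : measure_display) (T : measurableType d)
    (R : realType) (mu : {measure set T -> \bar R}) (D : set T)
    (g : T -> R[i]) : R[i] :=
  (\int[mu]_(x in D) complex.Re (g x)) +i* (\int[mu]_(x in D) complex.Im (g x)).

Definition fourier (R : realType) (f : R -> R) (t : R) : R[i] :=
  Cintegral (@lebesgue_measure R) setT
    (fun x : R => cexp (- ('i%C * t%:C * x%:C)) * (f x)%:C).

(* Main.v *)
Require Import Defs.
From mathcomp Require Import all_boot all_order all_algebra.
From mathcomp Require Import all_classical all_reals all_analysis.
From mathcomp Require Import measurable_realfun complex ring lra.

Set Implicit Arguments.
Unset Strict Implicit.
Unset Printing Implicit Defensive.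

Import Order.TTheory GRing.Theory Num.Theory.
Import numFieldNormedType.Exports.

Local Open Scope classical_set_scope.
Local Open Scope ring_scope.

(** The function [f] below is identically [1] on the points [n * pi] but falls
    under [4/5] within distance [1/(n+1)] of each of them, so it is not
    uniformly continuous; it is nevertheless integrable, because the width of
    its [n]-th spike decays geometrically.  An integrable [F f] would make [f]
    uniformly continuous, by Fourier inversion.

    Inversion ([fourier_inversion]) is proved by Abel summation.  Write
    [C t = \int f y cos(ty) dy] and [S t = \int f y sin(ty) dy], so that
    [F f = C - i S].  The cosine transform of the factor [exp(-a|t|)] is
    a Lorentzian ([abel_kernel]), hence by Fubini's theorem
    [\int exp(-a|t|) (C t cos(xt) + S t sin(xt)) dt
       = \int f y (2a / (a^2 + (x-y)^2)) dy],
    and the substitution [y = x + a u] turns the right-hand side into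
    [\int f(x + a u) (2 / (1 + u^2)) du].  Dominated convergence as [a] tends
    to [0], on the left with bound [|C| + |S|] and on the right with
    [f] bounded, gives
    [\int (C t cos(xt) + S t sin(xt)) dt = 2 pi f x].
    A last dominated convergence in [x] gives uniform continuity
    ([inversion_uniform_continuity]).

    The function is [f x = 1 / (1 + (exp|x| sin x)^2)] ([spikes]).  It is
    positive, continuous and at most [1] by its form.  Since
    [|sin y| >= |y| / 2] on [[-pi/2, pi/2]], for [x >= 0] it lies below a
    Lorentzian centred at the nearest multiple [k pi], of width proportional
    to [2^-k]; the sum of all these Lorentzians has a finite integral
    ([integrable_spikes]). *)

(** * Integration over the real line *)

Section real_line.
Context {R : realType}.
Local Notation mu := (@lebesgue_measure R).

Lemma le_integrable_real (f g : R -> R) :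
  measurable_fun setT f -> (forall x, `|f x| <= g x) ->
  mu.-integrable setT (EFin \o g) -> mu.-integrable setT (EFin \o f).
Proof.
move=> mf fg; apply: le_integrable => //; first exact/measurable_EFinP.
by move=> x _; rewrite lee_fin (le_trans (fg x))// ler_norm.
Qed.

Lemma Rdominated_convergence (f_ : nat -> R -> R) (f g : R -> R) :
  (forall n, measurable_fun setT (f_ n)) ->
  (forall x, f_ ^~ x @ \oo --> f x) ->
  mu.-integrable setT (EFin \o g) ->
  (forall n x, `|f_ n x| <= g x) ->
  \int[mu]_x (f_ n x) @[n --> \oo] --> \int[mu]_x (f x).
Proof.
move=> mf ff ig fg.
have mff : measurable_fun setT f.
  by apply: measurable_fun_cvg mf _ => x _; exact: ff.
have [] := @dominated_convergence _ _ _ mu setT measurableT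
  (fun n => EFin \o f_ n) (EFin \o f) (EFin \o g); last first.
- move=> if_ _ cf; apply: fine_cvg; rewrite fineK//.
  exact: integrable_fin_num.
- by apply: aeW => x n _ /=; rewrite lee_fin.
- by [].
- by apply: aeW => x _; apply/fine_cvgP; split; [exact: nearW|exact: ff].
- exact/measurable_EFinP.
- by move=> n; apply/measurable_EFinP; exact: mf.
Qed.

Lemma EFin_Rintegral (g : R -> R) : mu.-integrable setT (EFin \o g) ->
  ((\int[mu]_x g x)%:E = \int[mu]_x (g x)%:E)%E.
Proof. by move=> ig; rewrite fineK//; exact: integrable_fin_num. Qed.

Lemma ge0_integral_affine (G : R -> R) (x b : R) : 0 < b ->
  continuous G -> (forall y, 0 <= G y) ->
  (\int[mu]_y (G y)%:E = \int[mu]_u (G (x + b * u) * b)%:E)%E.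
Proof.
move=> b0 cG G0.
have dF (u : R) : is_derive u 1 (fun u => x + b * u) b.
  apply: is_derive_eq.
  by rewrite /GRing.scale/= ?(mulr1, mulr0, addr0, add0r) ?mul1r.
have F' : derive1 (fun u : R => x + b * u) = cst b.
  by apply/funext => u; rewrite derive1E; apply: derive_val.
rewrite (@increasing_ge0_integration_by_substitutionT _ (fun u => x + b * u))//.
- by rewrite F'.
- by move=> u v uv; rewrite ltrD2l ltr_pM2l.
- by rewrite F'; move=> u; exact: cvg_cst.
- by rewrite F'; exact: is_cvg_cst.
- by rewrite F'; exact: is_cvg_cst.
- have h : b * u @[u --> -oo] --> -oo.
    by apply: gt0_cvgMrNy => //; exact: cvg_id.
  exact: cvg_comp h (cvg_addrl_Ny x).
- have h : b * u @[u --> +oo] --> +oo.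
    by apply: gt0_cvgMry => //; exact: cvg_id.
  exact: cvg_comp h (cvg_addrl x).
Qed.

Lemma integral_oneDsqrV : (\int[mu]_x ((oneDsqr x)^-1)%:E = pi%:E)%E.
Proof.
rewrite ge0_symfun_integralT.
- by rewrite -set_itvcy integral0y_oneDsqr -EFinM mulrC divfK.
- by move=> x; rewrite invr_ge0.
- exact: continuous_oneDsqrV.
- by move=> x; rewrite /oneDsqr/= sqrrN.
Qed.

Lemma integrable_oneDsqrV :
  mu.-integrable setT (EFin \o (fun x : R => (oneDsqr x)^-1)).
Proof.
apply/integrableP; split.
  apply/measurable_EFinP; apply: continuous_measurable_fun.
  exact: continuous_oneDsqrV.
under eq_integral do rewrite /= ger0_norm ?invr_ge0//.
by rewrite integral_oneDsqrV ltry.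
Qed.

End real_line.

(** * Elementary bounds on sine and cosine *)

Section sine_cosine.
Context {R : realType}.
Implicit Types x y : R.

Lemma continuous_cosM (u : R) : continuous (fun t : R => cos (u * t)).
Proof.
by move=> t; apply/differentiable_continuous/derivable1_diffP; exact: ex_derive.
Qed.

Lemma continuous_sinM (u : R) : continuous (fun t : R => sin (u * t)).
Proof.
by move=> t; apply/differentiable_continuous/derivable1_diffP; exact: ex_derive.
Qed.

Lemma normr_cos_le1 (x : R) : `|cos x| <= 1.
Proof. by rewrite ler_norml cos_geN1 cos_le1. Qed.

Lemma normr_sin_le1 (x : R) : `|sin x| <= 1.
Proof. by rewrite ler_norml sin_geN1 sin_le1. Qed.

Lemma cos_lipschitz (x y : R) : `|cos x - cos y| <= `|x - y|.
Proof.
wlog yx : x y / y <= x => [h|].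
  by have [/h//|/ltW/h] := leP y x; rewrite distrC (distrC y).
have [c _ ->] := @MVT_segment R cos (fun z => - sin z) y x yx
  (fun z _ => is_derive_cos z) (continuous_subspaceT (@continuous_cos R)).
by rewrite normrM normrN ler_piMl// normr_sin_le1.
Qed.

Lemma sin_lipschitz (x y : R) : `|sin x - sin y| <= `|x - y|.
Proof.
wlog yx : x y / y <= x => [h|].
  by have [/h//|/ltW/h] := leP y x; rewrite distrC (distrC y).
have [c _ ->] := @MVT_segment R sin cos y x yx (fun z _ => is_derive_sin z)
  (continuous_subspaceT (@continuous_sin R)).
by rewrite normrM ler_piMl// normr_cos_le1.
Qed.

(** By the mean value theorem [sin a = a cos c] for some [c] between [0] and
    [a], and cosine decreases there. *)
Lemma sin_ge_mul_cos (a : R) : 0 <= a <= pi / 2 -> a * cos a <= sin a.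
Proof.
move=> /andP[a0 api].
have [c] := @MVT_segment R sin cos 0 a a0 (fun z _ => is_derive_sin z)
  (continuous_subspaceT (@continuous_sin R)).
rewrite in_itv/= sin0 !subr0 => /andP[c0 ca] ->; rewrite mulrC ler_wpM2r//.
have pi2 : a <= pi.
  by rewrite (le_trans api)// ler_pdivrMr// ler_peMr ?pi_ge0// ler1n.
move: ca; rewrite le_eqVlt => /predU1P[->//|ca].
by rewrite ltW// ltr_cos ?in_itv/= ?c0 ?a0 ?pi2 ?(le_trans (ltW ca)).
Qed.

(** [sin y = 2 sin(y/2) cos(y/2) >= y cos(y/2)^2 = y (1 + cos y) / 2]. *)
Lemma sin_ge_half (y : R) : 0 <= y <= pi / 2 -> y / 2 <= sin y.
Proof.
move=> /andP[y0 ypi].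
have h : y / 2 * cos (y / 2) <= sin (y / 2).
  by apply: sin_ge_mul_cos; apply/andP; split; [lra|lra].
have c2 : 0 <= cos (y / 2).
  apply: cos_ge0_pihalf; apply/andP; split; last lra.
  by rewrite (@le_trans _ _ 0) ?oppr_le0 ?divr_ge0 ?pi_ge0.
have cy : 0 <= cos y.
  apply: cos_ge0_pihalf; apply/andP; split => //.
  by rewrite (@le_trans _ _ 0) ?oppr_le0 ?divr_ge0 ?pi_ge0.
have yE : y = y / 2 *+ 2 by rewrite -mulr_natr divfK.
move: cy; rewrite {1}yE cos_mulr2n => cy.
rewrite [in leRHS]yE sin_mulr2n.
have := ler_wpM2l c2 h; nra.
Qed.

Lemma normr_sin_ge_half (y : R) : `|y| <= pi / 2 -> `|y| / 2 <= `|sin y|.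
Proof.
move=> ypi; have [y0|y0] := leP 0 y.
  rewrite (le_trans _ (ler_norm _))// ger0_norm//; apply: sin_ge_half.
  by rewrite y0 (le_trans _ ypi)// ler_norm.
rewrite -[in leRHS]normrN -sinN (le_trans _ (ler_norm _))// ltr0_norm//.
apply: sin_ge_half; rewrite oppr_ge0 (ltW y0) (le_trans _ ypi)//.
by rewrite -normrN ler_norm.
Qed.

Lemma normr_sinDnpi (x : R) (n : nat) : `|sin (x + n%:R * pi)| = `|sin x|.
Proof.
elim: n => [|n IH]; first by rewrite mul0r addr0.
by rewrite -natr1 mulrDl mul1r addrA sinDpi normrN.
Qed.

End sine_cosine.

(** * The Abel kernel *)

Section abel_kernel.
Context {R : realType}.
Local Notation mu := (@lebesgue_measure R).

(** Adding [1] to the cosine makes the integrand nonnegative, so that the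
    fundamental theorem of calculus on a half-line applies without any prior
    knowledge of integrability; [abel_kernel] removes the [1] by means of the
    case [u = 0]. *)
Lemma laplace_one_plus_cos (a u : R) : 0 < a ->
  (\int[mu]_(t in `[0%R, +oo[) (expR (- (a * t)) * (1 + cos (u * t)))%:E
   = (a^-1 + a / (a ^+ 2 + u ^+ 2))%:E)%E.
Proof.
move=> a0.
have a2u2 : a ^+ 2 + u ^+ 2 != 0.
  by rewrite gt_eqF// ltr_pwDl ?exprn_gt0// sqr_ge0.
pose F (t : R) : R := expR (- (a * t)) *
  (- a^-1 + (u * sin (u * t) - a * cos (u * t)) * (a ^+ 2 + u ^+ 2)^-1).
have dF (t : R) : is_derive t 1 F (expR (- (a * t)) * (1 + cos (u * t))).
  rewrite /F; apply: is_derive_eq.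
  rewrite /GRing.scale/= ?(mulr1, mulr0, addr0, add0r); field.
  by rewrite a2u2 gt_eqF.
have cf : continuous (fun t : R => expR (- (a * t)) * (1 + cos (u * t))).
  move=> t; apply/differentiable_continuous/derivable1_diffP.
  exact: ex_derive.
rewrite (@ge0_continuous_FTC2y _ _ F 0 0).
- rewrite /F !mulr0 oppr0 expR0 sin0 cos0 mul1r sub0e -EFinN; congr (_%:E).
  by field; rewrite a2u2 gt_eqF.
- by move=> x _; rewrite mulr_ge0 ?expR_ge0// -lerBlDl sub0r cos_geN1.
- exact: continuous_subspaceT.
- (* At infinity [F t] is squeezed by [expR (- (a * t)) * K]. *)
  pose K := a^-1 + (`|u| + a) * (a ^+ 2 + u ^+ 2)^-1.
  have h : expR (- (a * t)) * K @[t --> +oo] --> (0 : R).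
    rewrite -(mul0r K); apply: cvgM; last exact: cvg_cst.
    have at_y : a * t @[t --> +oo] --> +oo.
      by apply: gt0_cvgMry => //; exact: cvg_id.
    exact: cvg_comp at_y (@cvgr_expR R).
  apply/norm_cvg0P.
  apply: (@squeeze_cvgr _ _ _ _ (cst 0) (fun t => expR (- (a * t)) * K)) => //;
    last exact: cvg_cst.
  apply: nearW => t /=; rewrite normr_ge0/= /F normrM ger0_norm ?expR_ge0//.
  rewrite ler_wpM2l ?expR_ge0// /K.
  rewrite (le_trans (ler_normD _ _))// normrN gtr0_norm ?invr_gt0// lerD2l.
  rewrite normrM [X in _ * X]gtr0_norm; last first.
    by rewrite invr_gt0 ltr_pwDl ?exprn_gt0// sqr_ge0.
  rewrite ler_wpM2r//; first by rewrite invr_ge0 addr_ge0// sqr_ge0.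
  rewrite (le_trans (ler_normB _ _))// !normrM (gtr0_norm a0) lerD//.
    by rewrite ler_piMr// ler_norml sin_geN1 sin_le1.
  by rewrite ler_piMr ?(ltW a0)// ler_norml cos_geN1 cos_le1.
- by move=> x _; exact: ex_derive.
- apply: cvg_at_right_filter; apply/differentiable_continuous/derivable1_diffP.
  exact: ex_derive.
- by move=> x _; rewrite derive1E; apply: derive_val.
Qed.

Lemma continuous_expRN_norm (a : R) :
  continuous (fun t : R => expR (- (a * `|t|))).
Proof.
move=> t; apply: (@continuous_comp _ _ _ (fun t : R => - (a * `|t|)) expR).
  by apply: cvgN; apply: cvgM; [exact: cvg_cst|apply: cvg_norm; exact: cvg_id].
exact: continuous_expR.
Qed.

Lemma abel_one_plus_cos (a u : R) : 0 < a ->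
  (\int[mu]_t (expR (- (a * `|t|)) * (1 + cos (u * t)))%:E
   = (2 * (a^-1 + a / (a ^+ 2 + u ^+ 2)))%:E)%E.
Proof.
move=> a0; rewrite ge0_symfun_integralT.
- rewrite EFinM -laplace_one_plus_cos// -set_itvcy; congr (_ * _)%E.
  apply: eq_integral => t; rewrite inE/= in_itv/= andbT => t0.
  by rewrite ger0_norm.
- by move=> t; rewrite mulr_ge0 ?expR_ge0// -lerBlDl sub0r cos_geN1.
- move=> t; apply: cvgM; first exact: continuous_expRN_norm.
  by apply: cvgD; [exact: cvg_cst|exact: continuous_cosM].
- by move=> t /=; rewrite normrN mulrN cosN.
Qed.

Lemma integrable_expRN_norm (a : R) : 0 < a ->
  mu.-integrable setT (EFin \o (fun t => expR (- (a * `|t|)))).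
Proof.
move=> a0; apply: (@le_integrable_real _ _
  (fun t => expR (- (a * `|t|)) * (1 + cos (0 * t)))).
- apply: continuous_measurable_fun; exact: continuous_expRN_norm.
- move=> t; rewrite ger0_norm ?expR_ge0// mul0r cos0.
  by rewrite ler_peMr ?expR_ge0// lerDl.
- apply/integrableP; split.
    apply/measurable_EFinP; apply: continuous_measurable_fun => t.
    apply: cvgM; first exact: continuous_expRN_norm.
    by apply: cvgD; [exact: cvg_cst|exact: continuous_cosM].
  under eq_integral do rewrite /= ger0_norm ?(mulr_ge0, expR_ge0)//
    -?lerBlDl ?sub0r ?cos_geN1//.
  by rewrite abel_one_plus_cos// ltry.
Qed.

Lemma integrable_abel_cos (a u : R) : 0 < a ->
  mu.-integrable setT (EFin \o (fun t => expR (- (a * `|t|)) * cos (u * t))).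
Proof.
move=> a0; apply: le_integrable_real (integrable_expRN_norm a0).
  apply: continuous_measurable_fun => t.
  by apply: cvgM; [exact: continuous_expRN_norm|exact: continuous_cosM].
move=> t; rewrite normrM ger0_norm ?expR_ge0// ler_piMr ?expR_ge0//.
by rewrite ler_norml cos_geN1 cos_le1.
Qed.

Lemma abel_kernel (a u : R) : 0 < a ->
  \int[mu]_t (expR (- (a * `|t|)) * cos (u * t)) = 2 * a / (a ^+ 2 + u ^+ 2).
Proof.
move=> a0.
have h v : \int[mu]_t expR (- (a * `|t|)) +
    \int[mu]_t (expR (- (a * `|t|)) * cos (v * t))
    = 2 * (a^-1 + a / (a ^+ 2 + v ^+ 2)).
  rewrite -RintegralD//; [|exact: integrable_expRN_norm|
                           exact: integrable_abel_cos].
  rewrite /Rintegral; under eq_integral do rewrite -{1}(mulr1 (expR _)) -mulrDr.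
  by rewrite abel_one_plus_cos.
have h0 : \int[mu]_t (expR (- (a * `|t|)) * cos (0 * t)) =
    \int[mu]_t expR (- (a * `|t|)).
  by apply: eq_Rintegral => t _; rewrite mul0r cos0 mulr1.
have a2u2 : a ^+ 2 + u ^+ 2 != 0.
  by rewrite gt_eqF// ltr_pwDl ?exprn_gt0// sqr_ge0.
move: (h 0) (h u); rewrite h0 => e0 eu.
have -> : \int[mu]_t (expR (- (a * `|t|)) * cos (u * t)) =
    2 * (a^-1 + a / (a ^+ 2 + u ^+ 2)) - (a^-1 + a / (a ^+ 2 + 0 ^+ 2)) by lra.
field.
by rewrite a2u2 gt_eqF.
Qed.

End abel_kernel.

(** * Fourier inversion *)

Section transforms.
Context {R : realType}.
Local Notation mu := (@lebesgue_measure R).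

Definition cos_transform (f : R -> R) (t : R) := \int[mu]_y (f y * cos (t * y)).

Definition sin_transform (f : R -> R) (t : R) := \int[mu]_y (f y * sin (t * y)).

(** The real part of [F f(t) exp(ixt)]; it suffices to recover a
    real-valued [f]. *)
Definition inverse_integrand (f : R -> R) (x t : R) :=
  cos_transform f t * cos (x * t) + sin_transform f t * sin (x * t).

Lemma integrable_bounded_mul (f h : R -> R) :
  mu.-integrable setT (EFin \o f) -> measurable_fun setT h ->
  (forall y, `|h y| <= 1) -> mu.-integrable setT (EFin \o (fun y => f y * h y)).
Proof.
move=> intf mh h1.
have mf : measurable_fun setT f.
  by apply/measurable_EFinP; exact: measurable_int intf.
apply: (@le_integrable_real _ _ (fun y => `|f y|)).
- exact: measurable_funM.
- by move=> y; rewrite normrM ler_piMr.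
- exact: (integrable_norm intf).
Qed.

Lemma integrable_mul_cos (f : R -> R) (t : R) :
  mu.-integrable setT (EFin \o f) ->
  mu.-integrable setT (EFin \o (fun y => f y * cos (t * y))).
Proof.
move=> intf; apply: integrable_bounded_mul => //.
  by apply: continuous_measurable_fun; exact: continuous_cosM.
by move=> y; exact: normr_cos_le1.
Qed.

Lemma integrable_mul_sin (f : R -> R) (t : R) :
  mu.-integrable setT (EFin \o f) ->
  mu.-integrable setT (EFin \o (fun y => f y * sin (t * y))).
Proof.
move=> intf; apply: integrable_bounded_mul => //.
  by apply: continuous_measurable_fun; exact: continuous_sinM.
by move=> y; exact: normr_sin_le1.
Qed.

Lemma inverse_integrandE (f : R -> R) (x t : R) :
  mu.-integrable setT (EFin \o f) ->
  inverse_integrand f x t = \int[mu]_y (f y * cos ((x - y) * t)).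
Proof.
move=> intf; rewrite /inverse_integrand.
rewrite -RintegralZr//; last exact: integrable_mul_cos.
rewrite -RintegralZr//; last exact: integrable_mul_sin.
rewrite -RintegralD//.
- by apply: eq_Rintegral => y _; rewrite mulrBl cosB (mulrC y t); ring.
- apply: integrable_bounded_mul; first exact: integrable_mul_cos.
    exact: measurable_cst.
  by move=> _; exact: normr_cos_le1.
- apply: integrable_bounded_mul; first exact: integrable_mul_sin.
    exact: measurable_cst.
  by move=> _; exact: normr_sin_le1.
Qed.

(** Both sides are iterated integrals of [exp(-a|t|) f y cos((x-y)t)], which is
    dominated by the product of two integrable functions of one variable. *)
Lemma abel_mean_inverse_integrand (f : R -> R) (x a : R) : 0 < a ->
  mu.-integrable setT (EFin \o f) ->
  \int[mu]_t (expR (- (a * `|t|)) * inverse_integrand f x t) =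
  \int[mu]_y (f y * (2 * a / (a ^+ 2 + (x - y) ^+ 2))).
Proof.
move=> a0 intf.
have mf : measurable_fun setT f.
  by apply/measurable_EFinP; exact: measurable_int intf.
pose e (t : R) : R := expR (- (a * `|t|)).
have me : measurable_fun setT e.
  by apply: continuous_measurable_fun; exact: continuous_expRN_norm.
have inty t : mu.-integrable setT (EFin \o (fun y => f y * cos ((x - y) * t))).
  apply: integrable_bounded_mul => //; last by move=> y; exact: normr_cos_le1.
  apply: continuous_measurable_fun => y.
  by apply/differentiable_continuous/derivable1_diffP; exact: ex_derive.
pose F (p : R * R) : \bar R := (e p.1 * (f p.2 * cos ((x - p.2) * p.1)))%:E.
have mF : measurable_fun setT F.
  apply/measurable_EFinP; apply: measurable_funM.
    by apply: (measurableT_comp me); exact: measurable_fst.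
  apply: measurable_funM.
    by apply: (measurableT_comp mf); exact: measurable_snd.
  apply: measurableT_comp.
    by apply: continuous_measurable_fun; exact: continuous_cos.
  apply: measurable_funM; last exact: measurable_fst.
  by apply: measurable_funB; [exact: measurable_cst|exact: measurable_snd].
have mFt t : measurable_fun setT (fun y => F (t, y)).
  by apply: (measurableT_comp mF); exact: measurable_pair1.
have intF : (mu \x mu)%E.-integrable setT F.
  apply/integrable12ltyP => //.
  apply: (@le_lt_trans _ _ (\int[mu]_t (e t * \int[mu]_y `|f y|)%:E)%E).
    apply: ge0_le_integral => //.
    - by move=> t _; exact: integral_ge0.
    - have := @measurable_fun_fubini_tonelli_F _ _ _ _ _ mu (abse \o F).
      by apply => //=; exact: measurableT_comp.
    - apply/measurable_EFinP; apply: measurable_funM => //.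
    - move=> t _; rewrite EFinM EFin_Rintegral; last first.
        exact: (integrable_norm intf).
      rewrite -ge0_integralZl//; last 2 first.
      + by apply/measurable_EFinP; exact: measurableT_comp.
      + by rewrite lee_fin expR_ge0.
      apply: ge0_le_integral => //.
      + by apply: measurableT_comp => //; exact: mFt.
      + apply/measurable_EFinP; apply: measurable_funM => //.
        exact: measurableT_comp.
      + move=> y _; rewrite -EFinM/= lee_fin !normrM ger0_norm ?expR_ge0//.
        by rewrite ler_wpM2l ?expR_ge0// ler_piMr// normr_cos_le1.
  under eq_integral do rewrite EFinM muleC.
  rewrite ge0_integralZl ?lee_fin ?Rintegral_ge0//; last 2 first.
  + exact/measurable_EFinP.
  + by move=> y _; rewrite lee_fin expR_ge0.
  rewrite lte_mul_pinfty ?lee_fin ?Rintegral_ge0//.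
  by apply: integrable_lty => //; exact: integrable_expRN_norm.
have := Fubini intF.
rewrite (_ : (fun t => _) =
    (fun t => (e t * inverse_integrand f x t)%:E)); last first.
  apply/funext => t; rewrite inverse_integrandE// -RintegralZl//.
  rewrite EFin_Rintegral//.
  exact: (integrableZl _ _ (inty t)).
rewrite [in X in _ = X -> _](_ : (fun y => _) =
    (fun y => (f y * (2 * a / (a ^+ 2 + (x - y) ^+ 2)))%:E)); last first.
  apply/funext => y; rewrite -(abel_kernel _ a0) -RintegralZl//; last first.
    exact: integrable_abel_cos.
  rewrite EFin_Rintegral//; last first.
    exact: (integrableZl _ _ (integrable_abel_cos _ a0)).
  by apply: eq_integral => t _; rewrite /F/=; congr (_%:E); rewrite mulrCA.
by rewrite /Rintegral => ->.
Qed.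

(** This is the substitution [y = x + a u]. *)
Lemma lorentz_mean_rescale (f : R -> R) (x a : R) : 0 < a ->
  continuous f -> (forall y, 0 <= f y) ->
  \int[mu]_y (f y * (2 * a / (a ^+ 2 + (x - y) ^+ 2))) =
  \int[mu]_u (f (x + a * u) * (2 * (oneDsqr u)^-1)).
Proof.
move=> a0 cf f0.
have a2u2 u : a ^+ 2 + u ^+ 2 != 0.
  by rewrite gt_eqF// ltr_pwDl ?exprn_gt0// sqr_ge0.
rewrite /Rintegral (ge0_integral_affine x a0).
- congr fine; apply: eq_integral => u _; congr (_%:E).
  rewrite -mulrA; congr (_ * _); rewrite /oneDsqr; field.
  by rewrite opprD addrA subrr sub0r sqrrN exprMn -{1}(mulr1 (a ^+ 2)) -mulrDr;
     rewrite mulf_neq0 ?expf_neq0 ?gt_eqF// ltr_pwDl// sqr_ge0.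
- move=> y; apply: cvgM; first exact: cf.
  apply: cvgM; first exact: cvg_cst.
  apply: cvgV; first exact: a2u2.
  have : continuous (fun y : R => a ^+ 2 + (x - y) ^+ 2); last exact.
  move=> z; apply/differentiable_continuous/derivable1_diffP.
  exact: ex_derive.
- move=> y; rewrite mulr_ge0// divr_ge0//; first by rewrite mulr_ge0// ltW.
  by rewrite addr_ge0// sqr_ge0.
Qed.

Section inversion.
Variables (f : R -> R) (M : R).
Hypotheses (cf : continuous f) (f0 : forall y, 0 <= f y)
  (fM : forall y, f y <= M).
Hypothesis intf : mu.-integrable setT (EFin \o f).
Hypothesis intC : mu.-integrable setT (EFin \o cos_transform f).
Hypothesis intS : mu.-integrable setT (EFin \o sin_transform f).

Let dom t := `|cos_transform f t| + `|sin_transform f t|.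

Let int_dom : mu.-integrable setT (EFin \o dom).
Proof.
exact: (integrableD _ (integrable_norm intC) (integrable_norm intS)).
Qed.

Let mI x : measurable_fun setT (inverse_integrand f x).
Proof.
apply: measurable_funD; apply: measurable_funM.
- by apply/measurable_EFinP; exact: measurable_int intC.
- by apply: continuous_measurable_fun; exact: continuous_cosM.
- by apply/measurable_EFinP; exact: measurable_int intS.
- by apply: continuous_measurable_fun; exact: continuous_sinM.
Qed.

Let I_dom x t : `|inverse_integrand f x t| <= dom t.
Proof.
rewrite (le_trans (ler_normD _ _))// !normrM lerD// ler_piMr//.
  exact: normr_cos_le1.
exact: normr_sin_le1.
Qed.

Lemma integrable_inverse_integrand x :
  mu.-integrable setT (EFin \o inverse_integrand f x).
Proof. exact: le_integrable_real (mI x) (I_dom x) int_dom. Qed.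

(** The integrands converge to [f x * (2 / (1 + u^2))], by continuity
    of [f].  The scale [a] runs through the sequence [1/(n+1)] because the
    dominated convergence theorem concerns sequences. *)
Lemma cvg_mean_harmonic x :
  \int[mu]_u (f (x + @harmonic R n * u) * (2 * (oneDsqr u)^-1)) @[n --> \oo]
  --> 2 * pi * f x.
Proof.
have i2 := integrableZl measurableT 2 (@integrable_oneDsqrV R).
have -> : 2 * pi * f x = \int[mu]_u (f x * (2 * (oneDsqr u)^-1)).
  rewrite RintegralZl//= RintegralZl//=; last exact: integrable_oneDsqrV.
  have -> : \int[mu]_u (oneDsqr u)^-1 = pi.
    by rewrite /Rintegral integral_oneDsqrV.
  by rewrite mulrC.
apply: (@Rdominated_convergence _ _ _ (fun u => M * (2 * (oneDsqr u)^-1))).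
- move=> n; apply: measurable_funM.
    apply: (measurableT_comp (continuous_measurable_fun cf)).
    apply: continuous_measurable_fun => u.
    by apply/differentiable_continuous/derivable1_diffP; exact: ex_derive.
  apply: continuous_measurable_fun => u.
  by apply: cvgM; [exact: cvg_cst|exact: continuous_oneDsqrV].
- move=> u; apply: cvgM; last exact: cvg_cst.
  apply: continuous_cvg; first exact: cf.
  rewrite -{2}(addr0 x) -(mul0r u); apply: cvgD; first exact: cvg_cst.
  by apply: cvgM; [exact: cvg_harmonic|exact: cvg_cst].
- exact: (integrableZl measurableT M i2).
- move=> n u; rewrite ger0_norm ?mulr_ge0 ?invr_ge0//.
  by rewrite ler_wpM2r// mulr_ge0// invr_ge0.
Qed.

(** As [a = 1/(n+1)] tends to [0], the Abel means of the inverse integrand tend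
    to its integral, and by [abel_mean_inverse_integrand] they are Lorentzian
    means of [f]. *)
Lemma fourier_inversion x : \int[mu]_t inverse_integrand f x t = 2 * pi * f x.
Proof.
have h : \int[mu]_t (expR (- (@harmonic R n * `|t|)) * inverse_integrand f x t)
    @[n --> \oo] --> \int[mu]_t inverse_integrand f x t.
  apply: Rdominated_convergence int_dom _.
  - move=> n; apply: measurable_funM => //.
    by apply: continuous_measurable_fun; exact: continuous_expRN_norm.
  - move=> t; rewrite -[X in _ --> X]mul1r; apply: cvgM; last exact: cvg_cst.
    rewrite -expR0; apply: continuous_cvg; first exact: continuous_expR.
    rewrite -oppr0 -(mul0r `|t|); apply: cvgN.
    by apply: cvgM; [exact: cvg_harmonic|exact: cvg_cst].
  - move=> n t; rewrite normrM (le_trans _ (I_dom x t))// ler_piMl//.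
    rewrite ger0_norm ?expR_ge0// -expR0 ler_expR oppr_le0.
    by rewrite mulr_ge0// harmonic_ge0.
rewrite (_ : (fun n => _) =
    (fun n => \int[mu]_u (f (x + harmonic n * u) * (2 * (oneDsqr u)^-1)))) in h.
  exact: (cvg_unique (@norm_hausdorff _ _) h (@cvg_mean_harmonic x)).
apply/funext => n; rewrite abel_mean_inverse_integrand ?harmonic_gt0//.
by rewrite lorentz_mean_rescale ?harmonic_gt0.
Qed.

(** The difference of the inversion formulas at [u n] and [v n] has an
    integrand bounded by [2 (|C t| + |S t|)] and, cosine and sine being
    [1]-Lipschitz, tending to [0] for each [t]. *)
Lemma inversion_uniform_continuity (u v : nat -> R) :
  u n - v n @[n --> \oo] --> 0 -> f (u n) - f (v n) @[n --> \oo] --> 0.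
Proof.
move=> uv.
have h : \int[mu]_t (inverse_integrand f (u n) t - inverse_integrand f (v n) t)
    @[n --> \oo] --> (0 : R).
  have <- : \int[mu]_t (cst 0 t : R) = 0 by rewrite /Rintegral integral0.
  apply: (@Rdominated_convergence _ _ _ (fun t => 2 * dom t)).
  - by move=> n; exact: measurable_funB.
  - move=> t; apply/norm_cvg0P.
    apply: (@squeeze_cvgr _ _ _ _ (cst 0)
      (fun n => dom t * (`|u n - v n| * `|t|))).
    + apply: nearW => n; rewrite normr_ge0/=.
      rewrite (_ : _ - _ = cos_transform f t * (cos (u n * t) - cos (v n * t)) +
          sin_transform f t * (sin (u n * t) - sin (v n * t))); last first.
        by rewrite /inverse_integrand; ring.
      rewrite (le_trans (ler_normD _ _))// !normrM mulrDl lerD// ler_wpM2l//.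
        by rewrite -normrM mulrBl cos_lipschitz.
      by rewrite -normrM mulrBl sin_lipschitz.
    + exact: cvg_cst.
    + rewrite -(mulr0 (dom t)) -(mul0r `|t|) -(normr0 R).
      apply: cvgM; first exact: cvg_cst.
      by apply: cvgM; [exact: cvg_norm|exact: cvg_cst].
  - exact: (integrableZl measurableT 2 int_dom).
  - move=> n t; rewrite (le_trans (ler_normB _ _))// mulr_natl mulr2n.
    by rewrite lerD.
rewrite (_ : (fun n => _) =
    (fun n => 2 * pi * (f (u n) - f (v n)))) in h; last first.
  apply/funext => n; rewrite RintegralB//;
    [|exact: integrable_inverse_integrand..].
  by rewrite !fourier_inversion mulrBr.
have p0 : 2 * pi != 0 :> R by rewrite mulf_neq0// gt_eqF// pi_gt0.
rewrite -(mulr0 (2 * pi)^-1) (_ : (fun n => _) =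
  (fun n => (2 * pi)^-1 * (2 * pi * (f (u n) - f (v n))))).
  by apply: cvgM => //; exact: cvg_cst.
by apply/funext => n; rewrite mulrA mulVf// mul1r.
Qed.

End inversion.

End transforms.

(** * The complex Fourier transform *)

Section fourier.
Context {R : realType}.
Local Notation mu := (@lebesgue_measure R).

Lemma fourierE (f : R -> R) t : mu.-integrable setT (EFin \o f) ->
  fourier f t = Complex (cos_transform f t) (- sin_transform f t).
Proof.
move=> intf; rewrite /fourier /Cintegral; congr Complex.
  apply: eq_Rintegral => x _; rewrite /cexp /=.
  rewrite !(mul0r, mulr0, mul1r, subr0, add0r, oppr0, expR0) cosN; ring.
rewrite -mulN1r -RintegralZl//; last exact: integrable_mul_sin.
apply: eq_Rintegral => x _; rewrite /cexp /=.
rewrite !(mul0r, mulr0, mul1r, subr0, addr0, add0r, oppr0, expR0) sinN; ring.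
Qed.

(** The real and imaginary parts are dominated by the modulus. *)
Lemma cintegrable_fourier (f : R -> R) : mu.-integrable setT (EFin \o f) ->
  cintegrable mu setT (fourier f) ->
  mu.-integrable setT (EFin \o cos_transform f) /\
  mu.-integrable setT (EFin \o sin_transform f).
Proof.
move=> intf [].
have -> : fourier f =
    fun t => Complex (cos_transform f t) (- sin_transform f t).
  by apply/funext => t; exact: fourierE.
rewrite /cmeasurable_fun /= => -[mC mNS] norm_lty.
have mS : measurable_fun setT (sin_transform f).
  rewrite (_ : sin_transform f = \- (fun t => - sin_transform f t)).
    exact: measurable_funN.
  by apply/funext => t /=; rewrite opprK.
set N := fun t =>
  Num.sqrt (cos_transform f t ^+ 2 + (- sin_transform f t) ^+ 2).
have intN : mu.-integrable setT (EFin \o N).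
  apply/integrableP; split.
    apply/measurable_EFinP; apply: measurableT_comp.
      by apply: continuous_measurable_fun; exact: sqrt_continuous.
    by apply: measurable_funD; apply: measurable_funX.
  by under eq_integral do rewrite /= ger0_norm ?sqrtr_ge0//.
split; apply: le_integrable_real intN => // t.
  by rewrite -sqrtr_sqr ler_wsqrtr// lerDl sqr_ge0.
by rewrite -sqrtr_sqr ler_wsqrtr// sqrrN lerDr sqr_ge0.
Qed.

End fourier.

(** * A function with thinning spikes *)

Section spikes.
Context {R : realType}.
Local Notation mu := (@lebesgue_measure R).

Definition spikes (x : R) : R := (oneDsqr (expR `|x| * sin x))^-1.

Lemma spikes_gt0 x : 0 < spikes x.
Proof. by rewrite invr_gt0 (lt_le_trans ltr01)// oneDsqr_ge1. Qed.

Lemma spikes_le1 x : spikes x <= 1.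
Proof. exact: oneDsqrV_le1. Qed.

Lemma continuous_spikes : continuous spikes.
Proof.
move=> x; apply: (@continuous_comp _ _ _
  (fun x => expR `|x| * sin x) (fun y => (oneDsqr y)^-1)).
  apply: cvgM; last exact: continuous_sin.
  apply: continuous_cvg; first exact: continuous_expR.
  by apply: cvg_norm; exact: cvg_id.
exact: continuous_oneDsqrV.
Qed.

Lemma spikes_even : spikes =1 spikes \o -%R.
Proof.
by move=> x; rewrite /spikes/= normrN sinN mulrN /oneDsqr sqrrN.
Qed.

Lemma spikes_npi (n : nat) : spikes (n%:R * pi) = 1.
Proof.
rewrite /spikes (_ : sin _ = 0) ?mulr0.
  by rewrite /oneDsqr expr0n addr0 invr1.
by apply: normr0_eq0; rewrite -[n%:R * pi]add0r normr_sinDnpi sin0 normr0.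
Qed.

Lemma spikes_le (x b : R) : 0 <= b -> b <= expR `|x| * `|sin x| ->
  spikes x <= (oneDsqr b)^-1.
Proof.
move=> b0 h; rewrite lef_pV2 ?posrE ?(lt_le_trans ltr01) ?oneDsqr_ge1//.
rewrite lerD2l -(real_normK (num_real (expR _ * _))) normrM.
by rewrite ler_pXn2r ?nnegrE// ?(ger0_norm (expR_ge0 _))// mulr_ge0 ?expR_ge0.
Qed.

(** At distance [d = 1/(n+1)] from [n * pi] the sine is at least [d/2] in
    absolute value, while the exponential factor is at least
    [1 + n * pi >= 1/d]. *)
Lemma spikes_npiD_harmonic (n : nat) :
  spikes (n%:R * pi + harmonic n) <= (oneDsqr (2^-1))^-1.
Proof.
have h0 : 0 <= @harmonic R n := harmonic_ge0 n.
have p2 := @pi_ge2 R.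
have h1 : @harmonic R n <= 1 by rewrite invf_le1// ler1n.
apply: spikes_le => //.
rewrite [X in sin X]addrC normr_sinDnpi.
have s : harmonic n / 2 <= `|sin (harmonic n : R)|.
  rewrite -{1}(ger0_norm h0); apply: normr_sin_ge_half.
  by rewrite ger0_norm//; lra.
have e : n.+1%:R <= expR `|n%:R * pi + harmonic n : R|.
  rewrite (le_trans _ (expR_ge1Dx _))// -natr1 addrC lerD2l.
  rewrite ger0_norm ?addr_ge0 ?mulr_ge0 ?pi_ge0// (@le_trans _ _ (n%:R * pi))//.
    by rewrite ler_peMr//; lra.
  by rewrite lerDl.
rewrite (@le_trans _ _ (n.+1%:R * (harmonic n / 2)))//.
  by rewrite mulrA /harmonic mulfV// mul1r.
by apply: ler_pM => //; rewrite divr_ge0.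
Qed.

(** The inverse of the width of a Lorentzian that dominates the spike at
    [k * pi].  For [x >= k pi - pi/2] one has [x >= k - 2], hence
    [exp x / 2 >= exp(-2) 2^k / 2], the remaining factor [1/2] being that of
    [|sin y| >= |y| / 2]. *)
Definition spike_rate (k : nat) : R := expR (- 2) / 4 * 2 ^+ k.+1.

Lemma spike_rate_gt0 k : 0 < spike_rate k.
Proof. by rewrite mulr_gt0 ?exprn_gt0// divr_gt0 ?expR_gt0. Qed.

Lemma exists_near_npi (s : R) : 0 <= s ->
  exists k : nat, `|s - k%:R * pi| <= pi / 2.
Proof.
move=> s0; have p0 := @pi_gt0 R.
have q0 : 0 <= s / pi + 2^-1 by rewrite addr_ge0 ?divr_ge0 ?pi_ge0.
(* Rounding [s / pi] to the nearest integer. *)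
exists (Num.truncn (s / pi + 2^-1)).
have /andP[] := truncn_itv q0.
move: (Num.truncn _) => k h1; rewrite -(natr1 k) => h2.
have e : s - k%:R * pi = (s / pi - k%:R) * pi by rewrite mulrBl divfK ?gt_eqF.
rewrite e normrM (gtr0_norm p0) mulrC ler_pM2l// ler_norml.
by move: (s / pi) h1 h2 => q h1 h2; apply/andP; split; lra.
Qed.

Lemma spikes_le_lorentz (s : R) : 0 <= s ->
  exists k, spikes s <= (oneDsqr (spike_rate k * (s - k%:R * pi)))^-1.
Proof.
move=> s0; have [k hk] := exists_near_npi s0; exists k.
have w0 : 0 <= spike_rate k by rewrite mulr_ge0 ?exprn_ge0// divr_ge0 ?expR_ge0.
rewrite (_ : oneDsqr _ = oneDsqr (spike_rate k * `|s - k%:R * pi|)); last first.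
  by rewrite /oneDsqr !exprMn real_normK ?num_real.
apply: spikes_le; first by rewrite mulr_ge0.
have -> : `|sin s| = `|sin (s - k%:R * pi)|.
  by rewrite -(normr_sinDnpi (s - _) k) subrK.
rewrite (@le_trans _ _ (expR `|s| * (`|s - k%:R * pi| / 2)))//; last first.
  by rewrite ler_wpM2l ?expR_ge0// normr_sin_ge_half.
rewrite [in leRHS]mulrCA mulrC ler_wpM2l// /spike_rate.
have e : expR (- 2) * 2 ^+ k <= expR `|s|.
  have hs : - 2 + k%:R <= `|s|.
    have /andP[_ pi2] := @pihalf_02 R.
    have : k%:R <= k%:R * pi :> R by rewrite ler_peMr//; have := @pi_ge2 R; lra.
    by rewrite (ger0_norm s0); move: hk; rewrite ler_norml => /andP[]; lra.
  rewrite (le_trans _ (_ : expR (- 2 + k%:R) <= _)) ?ler_expR//.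
  rewrite expRD ler_wpM2l ?expR_ge0// -[k%:R]mulr1 expRM_natl.
  by rewrite lerXn2r ?nnegrE ?expR_ge0// (le_trans _ (expR_ge1Dx _)).
rewrite exprS; lra.
Qed.

Lemma integral_lorentz (x b : R) : 0 < b ->
  (\int[mu]_y ((oneDsqr (b * (y - x)))^-1)%:E = (pi / b)%:E)%E.
Proof.
move=> b0; have b'0 : 0 < b^-1 by rewrite invr_gt0.
rewrite (ge0_integral_affine x b'0).
- under eq_integral => u _.
    rewrite (_ : b * _ = u); last by field; rewrite gt_eqF.
    rewrite EFinM muleC; over.
  rewrite ge0_integralZl ?lee_fin ?(ltW b'0)//; last first.
  + apply/measurable_EFinP; apply: continuous_measurable_fun.
    exact: continuous_oneDsqrV.
  by rewrite integral_oneDsqrV -EFinM mulrC.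
- move=> y; apply: (@continuous_comp _ _ _
    (fun y => b * (y - x)) (fun y => (oneDsqr y)^-1)).
    by apply/differentiable_continuous/derivable1_diffP; exact: ex_derive.
  exact: continuous_oneDsqrV.
- by move=> y; rewrite invr_ge0.
Qed.

(** By symmetry only the half-line matters; there the function lies below the
    sum over [k] of the Lorentzians of [spikes_le_lorentz], whose integrals
    [pi / spike_rate k] form a geometric series. *)
Lemma integrable_spikes : mu.-integrable setT (EFin \o spikes).
Proof.
have mspikes : measurable_fun setT spikes.
  by apply: continuous_measurable_fun; exact: continuous_spikes.
pose L k (s : R) : \bar R := ((oneDsqr (spike_rate k * (s - k%:R * pi)))^-1)%:E.
have L0 k s : (0 <= L k s)%E by rewrite lee_fin invr_ge0.
have mL k D : measurable_fun D (L k).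
  apply: measurable_funTS; apply/measurable_EFinP.
  have cV := @continuous_oneDsqrV R.
  apply: (measurableT_comp (continuous_measurable_fun cV)).
  apply: continuous_measurable_fun => y.
  by apply/differentiable_continuous/derivable1_diffP; exact: ex_derive.
apply/integrableP; split; first exact/measurable_EFinP.
under eq_integral do rewrite /= ger0_norm ?(ltW (spikes_gt0 _))//.
rewrite ge0_symfun_integralT; last 3 first.
- by move=> x; exact/ltW/spikes_gt0.
- exact: continuous_spikes.
- exact: spikes_even.
rewrite lte_mul_pinfty// -set_itvcy.
apply: (@le_lt_trans _ _ (\int[mu]_(x in `[0%R, +oo[) (\sum_(k <oo) L k x))%E).
  apply: ge0_le_integral => //.
  - by move=> x Dx; rewrite lee_fin; exact/ltW/spikes_gt0.
  - by apply/measurable_EFinP; exact: measurable_funTS.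
  - by apply: ge0_emeasurable_sum => // k _; exact: mL.
  - move=> s; rewrite /= in_itv/= andbT => s0.
    have [k hk] := spikes_le_lorentz s0.
    rewrite (le_trans _ (nneseries_lim_ge k.+1 _))//.
    rewrite big_nat_recr//= (le_trans _ (leeDr _ _))//.
    by rewrite sume_ge0.
rewrite integral_nneseries//; last by move=> k; exact: mL.
apply: (@le_lt_trans _ _
  (\sum_(k <oo) ((pi * 4 / expR (- 2)) / (2 ^ (k + 1))%:R)%:E)%E).
  apply: lee_nneseries => k.
    by move=> _ _; exact: integral_ge0.
  move=> _; rewrite (_ : (_ / _)%R = pi / spike_rate k); last first.
    rewrite /spike_rate natrX addn1; field.
    by rewrite expf_neq0 ?gt_eqF ?expR_gt0.
  rewrite -(integral_lorentz (k%:R * pi) (spike_rate_gt0 k)).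
  by apply: ge0_subset_integral => //; exact: mL.
have := @cvg_geometric_eseries_half R (pi * 4 / expR (- 2)) 0.
by move=> /cvg_lim ->//; rewrite ltry.
Qed.

End spikes.

Theorem mainTheorem5 (R : realType) :
  exists f : R -> R,
    [/\ forall x : R, 0 < f x,
        [bounded f x | x in [set: R]],
        continuous f,
        (@lebesgue_measure R).-integrable [set: R] (EFin \o f) &
        ~ cintegrable (@lebesgue_measure R) [set: R] (fourier f)].
Proof.
exists spikes; split.
- exact: spikes_gt0.
- exists 1; split => // M M1 x _ /=.
  by rewrite ger0_norm ?(ltW (spikes_gt0 _))// (le_trans (spikes_le1 x))// ltW.
- exact: continuous_spikes.
- exact: integrable_spikes.
- move=> /(cintegrable_fourier (@integrable_spikes R))[intC intS].
  pose u n : R := n%:R * pi; pose v n := u n + harmonic n.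
  have uv : u n - v n @[n --> \oo] --> (0 : R).
    rewrite -oppr0 (_ : (fun n => _) = (fun n => - harmonic n)).
      by apply: cvgN; exact: cvg_harmonic.
    by apply/funext => n; rewrite /v opprD addrA subrr sub0r.
  have d0 := inversion_uniform_continuity (@continuous_spikes R)
    (fun y => ltW (spikes_gt0 y)) (@spikes_le1 R) (@integrable_spikes R)
    intC intS uv.
  have : 5^-1 <= 0 :> R.
    apply: (cvgr_to_ge d0); apply: nearW => n /=.
    have e : (oneDsqr (2^-1 : R))^-1 = 4 / 5 by rewrite /oneDsqr; field.
    rewrite /v /u spikes_npi.
    by have := @spikes_npiD_harmonic R n; rewrite e; lra.
  by rewrite invr_le0 lern0.
Qed.
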